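(* For any fixed integer $m$ and integers $t\geq s$ satisfying $s\geq 2m-2$ and $t\geq (s-1)!+1$, there are constants $c_1=c_1(s,t)>0$ and $c_2=c_2(s,t)$ such that $$c_1 n^{m-\binom{m}{2}/s}\leq ex(n,K_m,K_{s,t})\leq c_2 n^{m-\binom{m}{2}/s}.$$
   Context: For graphs $T$ and $H$ with no isolated vertices, $ex(n,T,H)$ denotes the maximum possible number of copies of $T$ in an $H$-free graph on $n$ vertices. $K_m$ is the complete graph on $m$ vertices and $K_{s,t}$ the complete bipartite graph with parts of sizes $s$ and $t$. *)

(* Defs.v *)
From mathcomp Require Import all_boot.

Set Implicit Arguments.
Unset Strict Implicit.
Unset Printing Implicit Defensive.

(* A simple graph with vertex type V is given by its set of edges, each edge
   being a two-element set of vertices. *)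
Definition simple_graph (V : finType) (E : {set {set V}}) : bool :=
  [forall e in E, #|e| == 2].

Definition embedding (U V : finType) (T : {set {set U}}) (G : {set {set V}})
    (f : {ffun U -> V}) : bool :=
  injectiveb f && [forall e in T, (f @: (e : {set U})) \in G].

(* The subgraph (vertex set, edge set) of the host graph traced out by f. *)
Definition image_graph (U V : finType) (T : {set {set U}}) (f : {ffun U -> V}) :
    {set V} * {set {set V}} :=
  (f @: [set: U], [set f @: (e : {set U}) | e in T]).

(* Copies are subgraphs (not necessarily induced): embeddings which differ by
   an automorphism of T have the same image and are counted once. *)
Definition copies (U V : finType) (T : {set {set U}}) (G : {set {set V}}) :
    {set {set V} * {set {set V}}} :=
  [set image_graph T f | f : {ffun U -> V} & embedding T G f].

Definition graph_free (U V : finType) (H : {set {set U}}) (G : {set {set V}}) :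
    bool :=
  copies H G == set0.

Definition ex (n : nat) (U W : finType) (T : {set {set U}}) (H : {set {set W}}) :
    nat :=
  \max_(G : {set {set 'I_n}} | simple_graph G && graph_free H G) #|copies T G|.

Definition complete_graph (m : nat) : {set {set 'I_m}} :=
  [set e : {set 'I_m} | #|e| == 2].

Definition complete_bipartite (s t : nat) : {set {set ('I_s + 'I_t)%type}} :=
  [set [set inl i; inr j] | i : 'I_s, j : 'I_t].

(* Main.v *)
(* Upper bound: in a K_{s,t}-free graph the neighbourhood of a vertex is
   K_{s-1,t}-free, so the cliques can be counted by induction on m, summing over
   the vertices a power of the degree; the s-th moment of the degrees is O(n^s)
   because s vertices have fewer than t common neighbours.

   Lower bound: take the projective norm graph on pairs (A, a), A in the field L
   with q^(s-1) elements, a^(q-1) = 1, joined when N(A + B) = ab; q is a power of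
   2, so that there are no loops. Its codegrees are so close to the average that
   every set U with |U|^2 >= 16 q^(s+1) has |U|/2 vertices with at least |U|/(2q)
   neighbours in U; as s >= 2m - 2, cliques can be built greedily.

   That graph is K_{s,(s-1)!+1}-free because a system
   prod_j (x_j - a_ij) = b_i (i, j < k), with the a_ij distinct in each column,
   has at most k! solutions. Modulo the d-th power of the ideal of the system
   every polynomial is a combination of monomials with all exponents below
   k + d, a space of dimension (k + d)^k, while jets of order d at N solutions
   give N * C(k + d - 1, k) independent conditions; let d tend to infinity. *)
Require Import Defs.
From HB Require Import structures.
From mathcomp Require Import all_boot all_order all_algebra all_field.
From mathcomp Require Import ring lra zify.

Set Implicit Arguments.
Unset Strict Implicit.
Unset Printing Implicit Defensive.

(** * Cliques and copies of complete graphs *)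

(* Ordered cliques: each clique on m vertices is counted m! times. *)
Fixpoint cliques (V : finType) (e : rel V) (m : nat) (U : {set V}) : nat :=
  if m is m'.+1 then \sum_(v in U) cliques e m' [set w in U | e v w] else 1.

Lemma sum_tuple_recl (V : finType) (m : nat) (F : m.+1.-tuple V -> nat) :
  \sum_t F t = \sum_v \sum_(t : m.-tuple V) F [tuple of v :: t].
Proof.
rewrite pair_big /= (reindex (fun p : V * m.-tuple V => [tuple of p.1 :: p.2])) //=.
exists (fun t : m.+1.-tuple V => (thead t, [tuple of behead t])) => [[v t]|t] _ /=.
  by rewrite theadE; congr (_, _); apply: val_inj.
by rewrite [RHS]tuple_eta; apply: val_inj.
Qed.

Lemma card_cliques (V : finType) (e : rel V) (m : nat) (U : {set V}) :
  #|[set t : m.-tuple V | all (mem U) t && pairwise e t]| = cliques e m U.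
Proof.
elim: m U => [|m IHm] U.
  rewrite (_ : [set _ | _] = setT) ?cardsT ?card_tuple //.
  by apply/setP => t; rewrite !inE tuple0.
rewrite -sum1dep_card big_mkcond sum_tuple_recl /= [RHS]big_mkcond.
apply: eq_bigr => v _; case: ifP => vU; last by rewrite big1 // => t _; rewrite vU.
rewrite -IHm -sum1dep_card [RHS]big_mkcond; apply: eq_bigr => t _.
congr (if _ then _ else _); rewrite /= andbA -all_predI; congr (_ && _).
by apply: eq_all => w; rewrite /= !inE.
Qed.

Lemma cliquesS (V : finType) (e : rel V) (m : nat) (U : {set V}) :
  cliques e m.+1 U = \sum_(v in U) cliques e m [set w in U | e v w].
Proof. by []. Qed.

Lemma cliques1 (V : finType) (e : rel V) (U : {set V}) : cliques e 1 U = #|U|.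
Proof. by rewrite /= sum1_card. Qed.

(** Greedy choice: at least half of [U] may serve as first vertex, each leaving a neighbourhood in
    [U] of size at least [#|U|] / 2q. The sizes shrink by successive powers of 2q, whose product has
    exponent ['C(m.+1, 2)]. The last vertex needs no expansion, so [m - 1] shrinkings precede the
    last use of [expU]; the factor [(2 * q) ^ 2] on the right avoids a subtraction in the
    exponent. *)
Lemma cliques_lower (V : finType) (e : rel V) (q k : nat) : 0 < q ->
    (forall U : {set V}, 16 * q ^ k.+2 <= #|U| ^ 2 ->
      #|U| <= 2 * #|[set v in U | #|U| <= 2 * q * #|[set w in U | e v w]|]|) ->
  forall m (U : {set V}), 16 * q ^ k.+2 * (2 * q) ^ (2 * m) <= #|U| ^ 2 * (2 * q) ^ 2 ->
  #|U| ^ m.+1 <= cliques e m.+1 U * (2 ^ m * (2 * q) ^ 'C(m.+1, 2)).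
Proof.
move=> q_gt0 expU; have Q_gt0 : 0 < 2 * q by rewrite muln_gt0.
elim=> [|m IHm] U thr; first by rewrite cliques1 !muln1.
have {}thr : 16 * q ^ k.+2 * (2 * q) ^ (2 * m) <= #|U| ^ 2.
  by move: thr; rewrite mulnS addnC expnD mulnA leq_pmul2r // expn_gt0 Q_gt0.
have /expU : 16 * q ^ k.+2 <= #|U| ^ 2.
  by apply: leq_trans thr; rewrite leq_pmulr // expn_gt0 Q_gt0.
set G := [set v in U | _] => leG.
have good v : v \in G ->
    #|U| ^ m.+1 <= cliques e m.+1 [set w in U | e v w] * (2 ^ m * (2 * q) ^ 'C(m.+2, 2)).
  rewrite inE => /andP[_ leU].
  apply: leq_trans (_ : (2 * q) ^ m.+1 * #|[set w in U | e v w]| ^ m.+1 <= _).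
    by rewrite -expnMn leq_exp2r.
  rewrite [in leqRHS]binS bin1 expnD [in leqRHS]mulnA [leqRHS]mulnA [leqLHS]mulnC.
  rewrite leq_pmul2r ?expn_gt0 ?Q_gt0 // -mulnA IHm // (leq_trans thr) //.
  by rewrite mulnC -expnMn leq_exp2r.
apply: leq_trans (_ : 2 * (\sum_(v in G) #|U| ^ m.+1) <= _).
  by rewrite sum_nat_const mulnA expnS leq_mul2r leG orbT.
rewrite cliquesS [2 ^ _]expnS -mulnA [leqRHS]mulnCA leq_mul2l big_distrl /=.
rewrite [leqRHS](bigID (mem G)) /=; apply: leq_trans (leq_addr _ _).
rewrite (eq_bigl (fun v => (v \in U) && (v \in G))) => [|v]; last first.
  by rewrite inE andbA andbb.
by apply: leq_sum => v /andP[_]; apply: good.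
Qed.

Definition adj (V : finType) (G : {set {set V}}) : rel V :=
  fun x y => [set x; y] \in G.

Lemma adjC (V : finType) (G : {set {set V}}) : symmetric (adj G).
Proof. by move=> x y; rewrite /adj setUC. Qed.

Lemma adjxx (V : finType) (G : {set {set V}}) : simple_graph G ->
  forall x, adj G x x = false.
Proof.
move=> /forall_inP sG x; apply/negP => /sG.
by rewrite setUid cards1.
Qed.

Lemma pairwise_mktuple (V : finType) (e : rel V) (m : nat) (f : 'I_m -> V) :
  (forall i j, i != j -> e (f i) (f j)) -> pairwise e [tuple f i | i < m].
Proof.
move=> fe; rewrite /= pairwise_map.
have sub : subrel [rel i j : 'I_m | i != j] (relpre f e) by move=> i j /fe.
by apply: (sub_pairwise sub); rewrite -uniq_pairwise enum_uniq.
Qed.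

Lemma pairwise_tnth (V : finType) (e : rel V) (m : nat) (t : m.-tuple V) i j :
  symmetric e -> pairwise e t -> i != j -> e (tnth t i) (tnth t j).
Proof.
move=> sym_e; wlog lt_ij : i j / i < j => [wl pt|].
  by rewrite neq_ltn => /orP[] lt; [|rewrite sym_e]; apply: wl => //; rewrite neq_ltn lt.
have x0 := tnth t i.
move=> /(pairwiseP x0) et _; rewrite !(tnth_nth x0).
by apply: et; rewrite ?inE ?size_tuple.
Qed.

Lemma embedding_completeP (V : finType) (G : {set {set V}}) (m : nat)
    (f : {ffun 'I_m -> V}) : simple_graph G ->
  reflect (forall i j, i != j -> adj G (f i) (f j)) (embedding (complete_graph m) G f).
Proof.
move=> sG; apply: (iffP andP) => [[_ /forall_inP fG] i j neij|fG].
  have := fG [set i; j]; rewrite imsetU1 imset_set1; apply.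
  by rewrite inE cards2 neij.
split.
  apply/injectiveP => i j eij; apply/eqP; apply: contraT => /fG.
  by rewrite eij adjxx.
apply/forall_inP => E; rewrite inE => /cards2P[i [j [neij ->]]].
by rewrite imsetU1 imset_set1; apply: fG.
Qed.

Lemma copies_complete_le (V : finType) (G : {set {set V}}) (m : nat) : simple_graph G ->
  #|copies (complete_graph m) G| <= cliques (adj G) m [set: V].
Proof.
move=> sG; apply: leq_trans (leq_imset_card _ _) _; rewrite -card_cliques.
pose F (f : {ffun 'I_m -> V}) := [tuple f i | i < m].
rewrite -(card_imset _ (_ : injective F)).
  apply/subset_leq_card/subsetP => _ /imsetP[f + ->]; rewrite !inE.
  move/(embedding_completeP _ sG)/pairwise_mktuple => ->.
  by rewrite andbT; apply/allP => v _; rewrite inE.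
by move=> f g fg; apply/ffunP => i; rewrite -(tnth_mktuple f) -/(F f) fg tnth_mktuple.
Qed.

Lemma embedding_complete_le (V : finType) (G : {set {set V}}) (m : nat) : 0 < m ->
  #|[set f : {ffun 'I_m -> V} | embedding (complete_graph m) G f]| <=
  #|copies (complete_graph m) G| * m ^ m.
Proof.
move=> m_gt0; rewrite -sum1_card (partition_big (image_graph (complete_graph m))
  (mem (copies (complete_graph m) G))) /=; last first.
  by move=> f; rewrite inE => fG; apply: imset_f; rewrite inE.
rewrite -sum_nat_const; apply: leq_sum => c /imsetP[f _ ->].
rewrite sum1dep_card.
pose A := f @: [set: 'I_m].
apply: leq_trans (_ : #|(ffun_on A : simpl_pred {ffun 'I_m -> V})| <= _).
  apply/subset_leq_card/subsetP => g; rewrite inE => /andP[_ /eqP[gA _]].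
  by apply/ffun_onP => i; rewrite -/A /A -gA imset_f.
rewrite card_ffun_on card_ord leq_exp2r // -[leqRHS]card_ord -cardsT.
exact: leq_imset_card.
Qed.

(** * Forbidding K_{s,t} through common neighbourhoods *)

Definition common (V : finType) (e : rel V) (S : {set V}) : {set V} :=
  [set v | [forall u in S, e u v]].

(** A set [S] with [t] common neighbours would span a copy of K_{s,t}; the two sides are disjoint
    because the graph has no loops. *)
Lemma graph_free_common (V : finType) (G : {set {set V}}) (s t : nat) :
    simple_graph G -> 0 < s -> graph_free (complete_bipartite s t) G ->
  forall S : {set V}, #|S| = s -> #|common (adj G) S| < t.
Proof.
move=> sG s_gt0 /eqP free S cardS; rewrite ltnNge; apply/negP => le_t.
pose f : {ffun 'I_s + 'I_t -> V} := [ffun x => match x with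
  | inl i => enum_val (cast_ord (esym cardS) i)
  | inr j => enum_val (widen_ord le_t j) end].
have fl i : f (inl i) \in S by rewrite ffunE enum_valP.
have fr j : f (inr j) \in common (adj G) S by rewrite ffunE enum_valP.
have flr i j : adj G (f (inl i)) (f (inr j)).
  by have := fr j; rewrite inE => /forall_inP; apply.
have : image_graph (complete_bipartite s t) f \in copies (complete_bipartite s t) G.
  apply: imset_f; rewrite inE; apply/andP; split.
    apply/injectiveP => -[i|i] [j|j] eq_f.
    - by move: eq_f; rewrite !ffunE => /enum_val_inj/cast_ord_inj ->.
    - by have := flr i j; rewrite eq_f adjxx.
    - by have := flr j i; rewrite eq_f adjxx.
    - move: eq_f; rewrite !ffunE => /enum_val_inj/(congr1 val) /= ij.
      by congr inr; apply: val_inj.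
  apply/forall_inP => _ /imset2P[i j _ _ ->].
  by rewrite imsetU1 imset_set1; apply: flr.
by rewrite free inE.
Qed.

(** The relation is carried to ['I_n] by an injection [g], the other vertices being isolated. As [s]
    and [t] are positive, every vertex of K_{s,t} lies on an edge, so a copy would stay inside the
    image of [g]. *)
Lemma ex_complete_ge (W : finType) (e : rel W) (n m s t : nat) :
    symmetric e -> irreflexive e -> #|W| <= n -> 0 < m -> 0 < s -> 0 < t ->
    (forall S : {set W}, #|S| = s -> #|common e S| < t) ->
  cliques e m [set: W] <= ex n (complete_graph m) (complete_bipartite s t) * m ^ m.
Proof.
move=> sym_e irr_e leWn m_gt0 s_gt0 t_gt0 freeW.
pose g (w : W) : 'I_n := widen_ord leWn (enum_rank w).
have g_inj : injective g.
  by move=> u v /(congr1 val) /= uv; apply: enum_rank_inj; apply: val_inj.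
pose G : {set {set 'I_n}} := [set E | [exists u, exists v, e u v && (E == [set g u; g v])]].
have adjG x y : adj G x y -> exists u v, [/\ x = g u, y = g v & e u v].
  rewrite /adj inE => /existsP[u /existsP[v /andP[uv /eqP xy]]].
  have uv_neq : g u != g v by apply: contraTneq uv => /g_inj ->; rewrite irr_e.
  have : x \in [set g u; g v] by rewrite -xy set21.
  have : y \in [set g u; g v] by rewrite -xy set22.
  have xy_neq : x != y.
    apply: contraNneq uv_neq => exy; move: xy; rewrite exy setUid => yE.
    have : g u \in [set y] by rewrite yE set21.
    have : g v \in [set y] by rewrite yE set22.
    by rewrite !inE => /eqP -> /eqP ->.
  rewrite !inE => /orP[] /eqP yE /orP[] /eqP xE.
  - by rewrite xE yE eqxx in xy_neq.
  - by exists v, u; rewrite sym_e.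
  - by exists u, v.
  - by rewrite xE yE eqxx in xy_neq.
have sG : simple_graph G.
  apply/forall_inP => E; rewrite inE => /existsP[u /existsP[v /andP[uv /eqP->]]].
  by rewrite cards2 (contraTneq _ uv) // => /g_inj ->; rewrite irr_e.
have free : graph_free (complete_bipartite s t) G.
  rewrite /graph_free -subset0; apply/subsetP => c /imsetP[f fP _].
  move: fP; rewrite !inE => /andP[/injectiveP f_inj /forall_inP fG].
  have fadj i j : adj G (f (inl i)) (f (inr j)).
    have := fG [set inl i; inr j]; rewrite imsetU1 imset_set1; apply.
    exact: imset2_f.
  have /fin_all_exists[l lE] i : exists u, f (inl i) = g u.
    by have /adjG[u [v [-> _ _]]] := fadj i (Ordinal t_gt0); exists u.
  have /fin_all_exists[r rE] j : exists u, f (inr j) = g u.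
    by have /adjG[u [v [_ -> _]]] := fadj (Ordinal s_gt0) j; exists v.
  have e_lr i j : e (l i) (r j).
    have /adjG[u [v [+ + uv]]] := fadj i j.
    by rewrite lE rE => /g_inj -> /g_inj ->.
  have l_inj : injective l.
    by move=> i i' ii'; have := lE i; rewrite ii' -lE => /f_inj[].
  have r_inj : injective r.
    by move=> i i' ii'; have := rE i; rewrite ii' -rE => /f_inj[].
  have := freeW (l @: [set: 'I_s]); rewrite card_imset // cardsT card_ord.
  move=> /(_ erefl); rewrite ltnNge => /negP; case.
  rewrite -[leqLHS](card_ord t) -cardsT -(card_imset _ r_inj).
  apply/subset_leq_card/subsetP => _ /imsetP[j _ ->]; rewrite inE.
  by apply/forall_inP => _ /imsetP[i _ ->].
apply: leq_trans (_ : #|copies (complete_graph m) G| * m ^ m <= _); last first.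
  rewrite leq_mul2r; apply/orP; right.
  by rewrite /ex (bigmax_sup G) // sG.
apply: leq_trans (embedding_complete_le G m_gt0).
rewrite -card_cliques.
pose F (t : m.-tuple W) : {ffun 'I_m -> 'I_n} := [ffun i => g (tnth t i)].
have F_inj : injective F.
  move=> t1 t2 /ffunP t12; apply: eq_from_tnth => i.
  by have := t12 i; rewrite !ffunE => /g_inj.
rewrite -(card_imset _ F_inj); apply/subset_leq_card/subsetP => _ /imsetP[t1 + ->].
rewrite !inE => /andP[_ pt]; apply/embedding_completeP => // i j neij.
rewrite !ffunE /adj inE; apply/existsP; exists (tnth t1 i); apply/existsP.
by exists (tnth t1 j); rewrite eqxx pairwise_tnth.
Qed.

(** Witnessed by K_m itself: [s >= m] of its vertices would be all of them, and no vertex is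
    adjacent to all, itself included. This settles small [n] in the lower bound. *)
Lemma ex_complete_gt0 (n m s t : nat) :
    m <= n -> 0 < m -> 0 < s -> 0 < t -> m <= s ->
  0 < ex n (complete_graph m) (complete_bipartite s t).
Proof.
move=> le_mn m_gt0 s_gt0 t_gt0 le_ms.
have K_sym : symmetric [rel x y : 'I_m | x != y] by move=> x y; rewrite /= eq_sym.
have K_irr : irreflexive [rel x y : 'I_m | x != y] by move=> x; rewrite /= eqxx.
have K_free (S : {set 'I_m}) : #|S| = s -> #|common [rel x y : 'I_m | x != y] S| < t.
  move=> cardS; rewrite (_ : common _ S = set0) ?cards0 //; apply/setP => v.
  rewrite !inE; apply/negP => /forall_inP vS.
  have /setP/(_ v) : S = setT.
    apply/eqP; rewrite eqEcard subsetT cardsT card_ord.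
    by rewrite (leq_trans le_ms) ?cardS.
  by rewrite !inE => /vS; rewrite /= eqxx.
have le_ex := ex_complete_ge K_sym K_irr _ m_gt0 s_gt0 t_gt0 K_free.
have : 0 < cliques [rel x y : 'I_m | x != y] m [set: 'I_m].
  rewrite -card_cliques; apply/card_gt0P; exists [tuple i | i < m]; rewrite inE.
  rewrite pairwise_mktuple // andbT; apply/allP => i _; exact: in_setT.
by move=> /leq_trans/(_ (le_ex n _)); rewrite card_ord muln_gt0 => /(_ le_mn)/andP[].
Qed.

(** * Degree moments *)

(** Stated relative to [U] so that it passes to neighbourhoods, with [s] lowered by one, in the
    induction on the clique size. *)
Definition codegree_lt (V : finType) (e : rel V) (s t : nat) (U : {set V}) : Prop :=
  forall S : {set V}, S \subset U -> #|S| = s -> #|common e S :&: U| < t.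

Lemma codegree_lt_nbhd (V : finType) (e : rel V) (s t : nat) (U : {set V}) v :
    symmetric e -> irreflexive e -> v \in U -> codegree_lt e s.+1 t U ->
  codegree_lt e s t [set w in U | e v w].
Proof.
move=> sym_e irr_e vU freeU S SU cardS.
have vS : v \notin S by apply: contraTN isT => /(subsetP SU); rewrite inE irr_e andbF.
apply: leq_ltn_trans (freeU (v |: S) _ _).
- apply/subset_leq_card/subsetP => w; rewrite !inE => /andP[/forall_inP Sw /andP[-> vw]].
  by rewrite andbT; apply/forall_inP => u; rewrite in_setU1 => /predU1P[->|/Sw].
- apply/subsetP => w; rewrite in_setU1 => /predU1P[->|/(subsetP SU)] //.
  by rewrite inE => /andP[].
by rewrite cardsU1 vS cardS.
Qed.

(** Once [d > 2 * s], every factor [d - i] of the falling factorial is at least d / 2; smaller [d]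
    are covered by the constant. *)
Lemma expn_le_bin (d s : nat) : d ^ s <= (2 * s) ^ s + 2 ^ s * s`! * 'C(d, s).
Proof.
have [le_d|lt_d] := leqP d (2 * s).
  apply: leq_trans (leq_addr _ _); case: s le_d => [|s] le_d; first by rewrite !expn0.
  by rewrite leq_exp2r.
apply: leq_trans (leq_addl _ _); rewrite -mulnA [s`! * _]mulnC bin_ffact ffact_prod.
rewrite -[in d ^ s](card_ord s) -[in 2 ^ s](card_ord s) -!prod_nat_const -big_split.
by apply: leq_prod => i _; have := ltn_ord i; rewrite /=; lia.
Qed.

(** Double counting of the pairs of a vertex and an [s]-subset of its neighbourhood. *)
Lemma sum_bin_degree (V : finType) (e : rel V) (s t : nat) (U : {set V}) :
    symmetric e -> codegree_lt e s t U ->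
  \sum_(v in U) 'C(#|[set w in U | e v w]|, s) <= 'C(#|U|, s) * t.
Proof.
move=> sym_e freeU.
under eq_bigr => v _ do rewrite -cards_draws -sum1dep_card big_mkcond.
rewrite exchange_big /= -cards_draws -sum1dep_card big_distrl /= [leqRHS]big_mkcond.
apply: leq_sum => S _; rewrite -big_mkcondr sum1dep_card.
have [/andP[SU /eqP cardS]|noS] := boolP ((S \subset U) && (#|S| == s)).
  rewrite mul1n ltnW // (leq_ltn_trans _ (freeU S SU cardS)) //.
  apply/subset_leq_card/subsetP => v; rewrite !inE => /andP[vU /andP[/subsetP Sv _]].
  rewrite vU andbT; apply/forall_inP => u /Sv.
  by rewrite inE sym_e => /andP[].
rewrite leqn0 cards_eq0 -subset0; apply/subsetP => v; rewrite !inE.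
move=> /andP[_ /andP[Sv cardS]]; case/negP: noS; rewrite cardS andbT.
by apply: subset_trans Sv _; apply/subsetP => w; rewrite inE => /andP[].
Qed.

Lemma sum_degree_expn (V : finType) (e : rel V) (s t : nat) (U : {set V}) :
    0 < s -> symmetric e -> codegree_lt e s t U ->
  \sum_(v in U) #|[set w in U | e v w]| ^ s <= ((2 * s) ^ s + 2 ^ s * t) * #|U| ^ s.
Proof.
move=> s_gt0 sym_e freeU.
apply: leq_trans (leq_sum _ (fun v _ => expn_le_bin #|[set w in U | e v w]| s)) _.
rewrite big_split /= sum_nat_const -big_distrr /= mulnDl leq_add //.
  rewrite mulnC leq_mul2l; apply/orP; right.
  by case: #|U| => // n; rewrite -[leqLHS]expn1 leq_pexp2l.
rewrite -!mulnA leq_mul2l; apply/orP; right.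
apply: leq_trans (leq_mul (leqnn _) (sum_bin_degree sym_e freeU)) _.
rewrite mulnA [s`! * _]mulnC bin_ffact mulnC leq_mul2l; apply/orP; right.
rewrite ffact_prod -[in leqRHS](card_ord s) -prod_nat_const.
by apply: leq_prod => i _; apply: leq_subr.
Qed.

Import Order.TTheory GRing.Theory Num.Theory.
Local Open Scope ring_scope.

(** * The number of solutions of a norm system *)

(** Lagrange interpolation: [h (Some i)] is the term of node [i], vanishing at the other nodes, and
    [h None] is the difference between [g] and its interpolant, a multiple of the nodal
    polynomial. *)
Lemma lagrange_split (K : fieldType) (k : nat) (a : 'I_k -> K) (g : {poly K}) :
  injective a ->
  exists h : option 'I_k -> {poly K},
    [/\ g = \sum_o h o,
        forall o i, o != Some i -> ('X - (a i)%:P) %| h o,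
        forall i, (size (h (Some i)) <= k)%N &
        h None = 0 \/ (k < size (h None) <= size g)%N].
Proof.
move=> inj_a.
pose L i := \prod_(l | l != i) ('X - (a l)%:P).
pose P := \prod_l ('X - (a l)%:P).
have L_nz i : (L i).[a i] != 0.
  rewrite horner_prod; apply/prodf_neq0 => l nli.
  by rewrite !hornerE subr_eq0 (inj_eq inj_a) eq_sym.
have L_z i l : l != i -> (L i).[a l] = 0.
  by move=> nli; rewrite horner_prod (bigD1 l) //= !hornerE subrr mul0r.
have szP : size P = k.+1.
  by rewrite size_prod_XsubC -[index_enum _]enumT size_enum_ord.
have szL i : size (L i) = k.
  have := szP; rewrite /P (bigD1 i) //= size_Mmonic ?size_XsubC; first by case.
    by rewrite -size_poly_eq0 size_XsubC.
  by rewrite monic_prod // => j _; rewrite monicXsubC.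
pose r := \sum_i (g.[a i] / (L i).[a i]) *: L i.
have szr : (size r <= k)%N.
  apply: (leq_trans (size_sum _ _ _)); apply/bigmax_leqP => i _.
  by rewrite (leq_trans (size_scale_leq _ _)) ?szL.
have : P %| g - r.
  rewrite /P -(big_map a xpredT (fun c => 'X - c%:P)).
  apply: uniq_roots_dvdp; last first.
    by rewrite uniq_rootsE map_inj_uniq // index_enum_uniq.
  apply/allP => c /mapP[l _ ->]; rewrite /root !hornerE horner_sum.
  rewrite (bigD1 l) //= big1 => [|i nil].
    by rewrite !hornerE divfK ?L_nz // ?addr0 subrr.
  have nli : l != i by rewrite eq_sym.
  by rewrite hornerZ (L_z i l) // mulr0.
move=> dvdP.
exists (fun o => if o is Some i then (g.[a i] / (L i).[a i]) *: L i else g - r).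
split.
- rewrite (bigD1 None) //= (reindex_omap Some id) => [|[]//].
  rewrite [X in _ + X](_ : _ = r) ?subrK //.
  by apply: eq_bigl => i; rewrite /= eqxx.
- case=> [j|] i.
    rewrite (inj_eq (@Some_inj _)) => nji; rewrite -mul_polyC dvdp_mull //.
    by rewrite /L (bigD1 i) 1?eq_sym //= dvdp_mulr.
  by move=> _; apply: dvdp_trans dvdP; rewrite /P (bigD1 i) //= dvdp_mulr.
- by move=> i; rewrite (leq_trans (size_scale_leq _ _)) ?szL.
have [->|nz] := eqVneq (g - r) 0; [by left | right].
have lt : (k < size (g - r)%R)%N by rewrite -szP dvdp_leq.
rewrite lt /=; have := leq_trans lt (size_polyD _ _); rewrite size_polyN.
rewrite leq_max [(k < size r)%N]ltnNge szr orbF => ltg.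
by rewrite size_polyDl // size_polyN (leq_ltn_trans szr).
Qed.

(** The polynomial with separated variables prod_j g_j(X_j), evaluated at a point over the
    [K]-algebra [T]. *)
Definition prod_eval (K : fieldType) (T : comNzRingType) (io : {rmorphism K -> T})
    (k : nat) (x : 'I_k -> T) (g : 'I_k -> {poly K}) : T :=
  \prod_j (map_poly io (g j)).[x j].

(** * Reduction of polynomials modulo powers of the ideal of a system *)

Section Reduction.
Variables (K : fieldType) (T : comNzRingType) (io : {rmorphism K -> T}).
Variables (J : Type) (k : nat) (x : J -> 'I_k -> T).

(** The coefficients do not depend on [l]: one polynomial, with all exponents below [D], is
    evaluated at all points. *)
Definition mono_span (D : nat) (f : J -> T) : Prop :=
  exists c : {ffun 'I_k -> 'I_D} -> K,
    forall l, f l = \sum_e io (c e) * \prod_j x l j ^+ e j.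

Lemma mono_span0 D : mono_span D (fun=> 0).
Proof. by exists (fun=> 0) => l; rewrite big1 // => e _; rewrite rmorph0 mul0r. Qed.

Lemma mono_spanD D f g :
  mono_span D f -> mono_span D g -> mono_span D (fun l => f l + g l).
Proof.
move=> [c fE] [c' gE]; exists (fun e => c e + c' e) => l.
by rewrite fE gE -big_split; apply: eq_bigr => e _; rewrite rmorphD mulrDl.
Qed.

Lemma mono_spanZ D c f : mono_span D f -> mono_span D (fun l => io c * f l).
Proof.
move=> [c' fE]; exists (fun e => c * c' e) => l.
by rewrite fE mulr_sumr; apply: eq_bigr => e _; rewrite rmorphM mulrA.
Qed.

Lemma mono_span_prod D (g : 'I_k -> {poly K}) : (forall j, (size (g j) <= D)%N) ->
  mono_span D (fun l => prod_eval io (x l) g).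
Proof.
move=> szg; exists (fun e : {ffun 'I_k -> 'I_D} => \prod_j (g j)`_(e j)) => l.
rewrite /prod_eval.
under eq_bigr => j _.
  rewrite (@horner_coef_wide _ D) ?size_map_poly //.
  under eq_bigr => e _ do rewrite coef_map /=.
  over.
rewrite (bigA_distr_bigA (fun j (e : 'I_D) => io (g j)`_e * x l j ^+ e)) /=.
by apply: eq_bigr => e _; rewrite rmorph_prod big_split.
Qed.

Lemma eq_mono_span D f g : f =1 g -> mono_span D f -> mono_span D g.
Proof. by move=> fg [c fE]; exists c => l; rewrite -fg. Qed.

Lemma mono_span_sum D (I : Type) (r : seq I) (f : I -> J -> T) :
  (forall i, mono_span D (f i)) -> mono_span D (fun l => \sum_(i <- r) f i l).
Proof.
move=> fP; elim: r => [|i r IHr].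
  by apply: eq_mono_span (mono_span0 D) => l; rewrite big_nil.
by apply: eq_mono_span (mono_spanD (fP i) IHr) => l; rewrite big_cons.
Qed.

Lemma mono_span_lift D D' (phi f : J -> T) :
    (forall e : {ffun 'I_k -> 'I_D},
       mono_span D' (fun l => phi l * \prod_j x l j ^+ e j)) ->
  mono_span D f -> mono_span D' (fun l => phi l * f l).
Proof.
move=> phiP [c fE].
apply: eq_mono_span (mono_span_sum (index_enum _)
  (fun e : {ffun 'I_k -> 'I_D} => mono_spanZ (c e) (phiP e))) => l.
by rewrite fE mulr_sumr; apply: eq_bigr => e _; rewrite mulrCA.
Qed.

Lemma mono_span_mul_prod D D' (g : 'I_k -> {poly K}) f :
    (forall j, (size (g j) + D <= D'.+1)%N) ->
  mono_span D f -> mono_span D' (fun l => prod_eval io (x l) g * f l).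
Proof.
move=> szg; apply: mono_span_lift => e.
apply: eq_mono_span (mono_span_prod (g := fun j => g j * 'X^(e j)) _) => [l|j].
  rewrite /prod_eval -big_split; apply: eq_bigr => j _.
  by rewrite rmorphM /= map_polyXn hornerM hornerXn.
apply: (leq_trans (size_polyMleq _ _)); rewrite size_polyXn addnS /=.
by rewrite -ltnS (leq_trans _ (szg j)) // -addnS leq_add2l.
Qed.

Lemma mono_spanW D D' f : (D <= D')%N -> mono_span D f -> mono_span D' f.
Proof.
move=> leD /(@mono_span_mul_prod _ D' (fun=> 1)) spf.
apply: eq_mono_span (spf _) => [l|j]; last by rewrite size_poly1.
by rewrite /prod_eval big1 ?mul1r // => j _; rewrite rmorph1 hornerC.
Qed.

Variables (a : 'I_k -> 'I_k -> K) (b : 'I_k -> K) (tau : T).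
Hypothesis inj_a : forall j, injective (a^~ j).
Hypothesis tauP : forall i l, exists r,
  prod_eval io (x l) (fun j => 'X - (a i j)%:P) = io (b i) + tau * r.

(** By [tauP] the equations of the system hold modulo [tau], so [tau ^+ d] stands for the [d]-th
    power of its ideal. *)
Definition span_mod d D (f : J -> T) : Prop :=
  exists2 w, mono_span D w & forall l, exists r, f l = w l + tau ^+ d * r.

Lemma span_modD d D f g :
  span_mod d D f -> span_mod d D g -> span_mod d D (fun l => f l + g l).
Proof.
move=> [w wP fE] [w' w'P gE]; exists (fun l => w l + w' l); first exact: mono_spanD.
move=> l; have [r ->] := fE l; have [r' ->] := gE l; exists (r + r').
by rewrite mulrDr addrACA.
Qed.

Lemma eq_span_mod d D f g : f =1 g -> span_mod d D f -> span_mod d D g.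
Proof. by move=> fg [w wP fE]; exists w => // l; rewrite -fg. Qed.

Lemma mono_span_mod d D f : mono_span D f -> span_mod d D f.
Proof. by move=> fP; exists f => // l; exists 0; rewrite mulr0 addr0. Qed.

Lemma span_mod_sum d D (I : Type) (r : seq I) (f : I -> J -> T) :
  (forall i, span_mod d D (f i)) -> span_mod d D (fun l => \sum_(i <- r) f i l).
Proof.
move=> fP; elim: r => [|i r IHr].
  by apply: mono_span_mod; apply: eq_mono_span (mono_span0 D) => l; rewrite big_nil.
by apply: eq_span_mod (span_modD (fP i) IHr) => l; rewrite big_cons.
Qed.

(* Each g j is split into Lagrange polynomials and a multiple of the nodal
   polynomial. A term in which the nodal polynomial occurs uses at most k - 1
   of the k rows of a, so some product prod_j ('X_j - a i j) divides it; on the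
   points it equals b i modulo tau, which lowers the degree in every variable. *)
Lemma prod_eval_span_mod d g : span_mod d (k + d) (fun l => prod_eval io (x l) g).
Proof.
elim: d g => [|d IHd] g.
  exists (fun=> 0); first exact: mono_span0.
  by move=> l; exists (prod_eval io (x l) g); rewrite mul1r add0r.
(* Inner induction, for fixed [d], on the total excess of the sizes over [k]. *)
have [n] := ubnP (\sum_j (size (g j) - k))%N.
elim: n => // n IHn in g *; rewrite ltnS => le_n.
have /fin_all_exists[h hP] j := lagrange_split (g j) (@inj_a j).
pose term (p : {ffun 'I_k -> option 'I_k}) l := prod_eval io (x l) (fun j => h j (p j)).
apply: (@eq_span_mod _ _ (fun l => \sum_p term p l)) => [l|].
  rewrite -(bigA_distr_bigA (fun j o => (map_poly io (h j o)).[x l j])) /=.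
  apply: eq_bigr => j _; have [-> _ _ _] := hP j.
  by rewrite rmorph_sum horner_sum.
apply: span_mod_sum => p.
have [/existsP[j0 /eqP p0] | /existsPn noN] := boolP [exists j, p j == None]; last first.
  apply/mono_span_mod/(@mono_spanW k); first exact: leq_addr.
  apply: mono_span_prod => j; have [_ _ sz _] := hP j.
  by case: (p j) (noN j) => [i _ | //]; apply: sz.
have [/existsP[j1 /eqP p1] | /existsPn nz] := boolP [exists j, h j (p j) == 0].
  apply: mono_span_mod; apply: eq_mono_span (mono_span0 _) => l.
  by rewrite /term /prod_eval (bigD1 j1) //= p1 rmorph0 horner0 mul0r.
(* Pigeonhole: [p] has [k] arguments and takes the value [None], so it misses one of the [k] values
   [Some i]. *)
have /existsP[i /forallP pi] : [exists i, forall j, p j != Some i].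
  rewrite -[X in is_true X]negbK; apply/negP.
  rewrite negb_exists => /forallP noi.
  have : (#|[set: option 'I_k]| <= #|p @: [set: 'I_k]|)%N.
    apply/subset_leq_card/subsetP => -[i|] _; last by rewrite -p0 imset_f.
    by have := noi i; rewrite negb_forall => /existsP[j]; rewrite negbK => /eqP <-; rewrite imset_f.
  by move/leq_trans/(_ (leq_imset_card _ _)); rewrite !cardsT card_option card_ord ltnn.
have /fin_all_exists[g' g'E] j : exists q, h j (p j) = q * ('X - (a i j)%:P).
  by have [_ /(_ _ i (pi j)) /dvdpP[q ->] _ _] := hP j; exists q.
have szh j : size (h j (p j)) = (size (g' j)).+1.
  rewrite g'E size_Mmonic ?monicXsubC ?size_XsubC ?addn2 //.
  by have := nz j; rewrite /= g'E; apply: contra_neq => ->; rewrite mul0r.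
(* Removing the linear factor leaves no excess where [p j] is an index, and strictly lowers it where
   [p j] is [None]. *)
have le_g' j : (size (g' j) - k + (p j == None) <= size (g j) - k)%N.
  have [_ _ szS szN] := hP j; have := nz j; have := szh j.
  case: (p j) => [i'|] /= sz nz0.
    by rewrite addn0 (_ : (_ - _ = 0)%N) //; apply/eqP; rewrite subn_eq0 ltnW // -sz.
  case: szN => [h0|/andP[ltk ltg]]; first by rewrite h0 eqxx in nz0.
  rewrite sz in ltk ltg; rewrite addn1 ltn_sub2r //.
  by rewrite (leq_ltn_trans _ ltg) // -ltnS.
have lt_g' : (\sum_j (size (g' j) - k) < n)%N.
  have le_sum : (\sum_j (size (g' j) - k + (p j == None)) <= \sum_j (size (g j) - k))%N.
    by apply: leq_sum => j _; exact: le_g'.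
  apply: leq_trans le_n; apply: leq_trans le_sum.
  by rewrite big_split /= -addn1 leq_add2l (bigD1 j0) //= p0.
have [w1 w1P w1E] := IHn g' lt_g'; have [w2 w2P w2E] := IHd g'.
pose F l := prod_eval io (x l) (fun j => 'X - (a i j)%:P).
(* The term is g' F = b_i g' + (F - b_i) g'. The inner induction treats the first summand; in the
   second, F - b_i is a multiple of [tau], so g' is needed only modulo [tau ^+ d], and the factor F
   raises the exponent bound by one. *)
exists (fun l => (io (b i) * w1 l + F l * w2 l) + io (- b i) * w2 l).
  apply: mono_spanD; first apply: mono_spanD.
  - exact: mono_spanZ.
  - by rewrite addnS; apply: mono_span_mul_prod w2P => j; rewrite size_XsubC.
  - by apply: mono_spanZ; apply: mono_spanW w2P; rewrite addnS.
move=> l; have [r1 r1E] := w1E l; have [r2 r2E] := w2E l; have [r rE] := tauP i l.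
have -> : term p l = prod_eval io (x l) g' * F l.
  rewrite /term /F /prod_eval -big_split; apply: eq_bigr => j _.
  by rewrite g'E rmorphM hornerM.
exists (io (b i) * r1 + r * r2).
rewrite rmorphN /F rE mulrDr -[X in X + _]mulrC {1}r1E r2E exprS.
by ring.
Qed.
End Reduction.

Lemma exists_linear_dependence (K : fieldType) (I J : finType) (C : I -> J -> K) :
  (#|J| < #|I|)%N ->
  exists2 c : I -> K, exists i, c i != 0 & forall j, \sum_i c i * C i j = 0.
Proof.
move=> ltJI.
pose M : 'M[K]_(#|I|, #|J|) := \matrix_(i, j) C (enum_val i) (enum_val j).
have : kermx M != 0.
  rewrite -mxrank_eq0 mxrank_ker -lt0n subn_gt0.
  exact: leq_ltn_trans (rank_leq_col _) ltJI.
case/rowV0Pn=> v /sub_kermxP vM0 /rV0Pn[i0 vi0].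
exists (fun i => v 0 (enum_rank i)); first by exists (enum_val i0); rewrite enum_valK.
move=> j; have /matrixP/(_ 0 (enum_rank j)) := vM0; rewrite !mxE => vM0j.
apply: etrans vM0j; rewrite [RHS](reindex enum_rank) /=; last first.
  by exists enum_val => i _; rewrite (enum_rankK, enum_valK).
by apply: eq_bigr => i _; rewrite !mxE !enum_rankK.
Qed.

Lemma poly_horner0_addX (R : comNzRingType) (p : {poly R}) :
  exists r, p = (p.[0])%:P + 'X * r.
Proof.
have /factor_theorem[r] : root (p - (p.[0])%:P) 0 by rewrite /root !hornerE subrr.
by rewrite subr0 => pE; exists r; rewrite mulrC -pE addrC subrK.
Qed.

(** A factor with nonzero constant term does not change the order of vanishing at 0. *)
Lemma cancel_Xn (R : idomainType) (u p : {poly R}) (d : nat) :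
    u.[0] != 0 -> (exists r, u * p = 'X^d * r) -> exists r, p = 'X^d * r.
Proof.
move=> u0; elim: d p => [|d IHd] p [r upE]; first by exists p; rewrite mul1r.
have [p' pE] := poly_horner0_addX p.
have p0 : p.[0] = 0.
  have /eqP := congr1 (fun q => q.[0]) upE.
  rewrite /= exprS -mulrA !hornerM hornerX mul0r.
  by rewrite mulf_eq0 (negPf u0) => /eqP.
rewrite pE p0 add0r.
have [|r' ->] := IHd p'; last by exists r'; rewrite exprS mulrA.
exists r; have nzX : 'X != 0 :> {poly R} by rewrite polyX_eq0.
by apply: (mulfI nzX); rewrite mulrCA [RHS]mulrA -exprS -upE pE p0 add0r.
Qed.

Lemma digits_inj (d k : nat) (s t : k.-tuple 'I_d) :
  (\sum_(i < k) tnth s i * d ^ i = \sum_(i < k) tnth t i * d ^ i)%N -> s = t.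
Proof.
elim: k s t => [|k IHk] s t; first by rewrite [s]tuple0 [t]tuple0.
case/tupleP: s => x s; case/tupleP: t => y t.
rewrite !big_ord_recl !expn0 !muln1 /= !tnth0.
under eq_bigr => i _ do rewrite tnthS expnS mulnCA.
under [in RHS]eq_bigr => i _ do rewrite tnthS expnS mulnCA.
rewrite -!big_distrr /= => eq_st.
have d_gt0 : (0 < d)%N := leq_ltn_trans (leq0n x) (ltn_ord x).
have exy : x = y.
  apply: val_inj; have /(congr1 (modn^~ d)) := eq_st.
  by rewrite ![(_ + d * _)%N]addnC ![(d * _)%N]mulnC !modnMDl !modn_small.
subst y; congr [tuple of _ :: _]; apply: IHk.
by move/eqP: eq_st; rewrite eqn_add2l eqn_pmul2l // => /eqP.
Qed.

(* Compare leading coefficients in n, through Bernoulli's inequality. *)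
Lemma le_of_asymptotic (N M k : nat) :
  (forall n, N * n.+1 ^ k <= M * (n.+1 + k) ^ k)%N -> (N <= M)%N.
Proof.
case: k => [|k] bound; first by have := bound 0%N; rewrite !expn0 !muln1.
set K := k.+1 in bound *.
have bern (X : nat) j : ((X.+1 - j) * X.+1 ^ j <= X.+1 * X ^ j)%N.
  elim: j => [|j IHj]; first by rewrite subn0.
  rewrite !expnS; set u := (_ ^ j)%N in IHj *; set v := (_ ^ j)%N in IHj *.
  apply: leq_trans (_ : X * ((X.+1 - j) * u) <= _)%N; last first.
    by rewrite [leqRHS]mulnCA leq_mul2l IHj orbT.
  rewrite mulnA [leqRHS]mulnA leq_mul2r subSS; apply/orP; right.
  have [le_jX|/ltnW] := leqP j X; last by rewrite -subn_eq0 => /eqP->.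
  by rewrite subSn // !mulnS [((X - j) * X)%N]mulnC leq_add2r leq_subr.
rewrite leqNgt; apply/negP => ltMN.
(* Chosen so that (X + 1 - K)(M + 1) exceeds M (X + 1), by exactly 1 when the subtraction is not
   truncated. *)
pose X := (K * M.+1)%N.
have X_gt0 : (0 < X)%N by rewrite muln_gt0.
have b1 : (N * X ^ K <= M * X.+1 ^ K)%N.
  (* With [n.+1 = K * X] both bases are multiples of [K], and the power of [K] cancels. *)
  have := bound (K * X).-1; rewrite prednK ?muln_gt0 //.
  have -> : (K * X + K = K * X.+1)%N by rewrite mulnS addnC.
  by rewrite !expnMn !(mulnCA _ (K ^ K)%N) leq_pmul2l ?expn_gt0.
have b2 := bern X K.
have b3 : ((X.+1 - K) * N * X ^ K <= M * X.+1 * X ^ K)%N.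
  rewrite -!mulnA (leq_trans (leq_mul (leqnn _) b1)) // mulnCA.
  by rewrite leq_mul2l b2 orbT.
move: b3; rewrite leq_pmul2r ?expn_gt0 ?X_gt0 // => b3.
have : ((X.+1 - K) * M.+1 <= M * X.+1)%N.
  by apply: leq_trans b3; rewrite leq_mul2l ltMN orbT.
by rewrite /X; nia.
Qed.

(** * Independence of jets at the solutions *)

Section NormSystem.
Variables (K : fieldType) (k N : nat) (P : 'I_N -> 'I_k -> K).
Hypothesis inj_P : forall l l', (forall i, P l i = P l' i) -> l = l'.

Let A := {poly {poly K}}.
Let io : {rmorphism K -> A} := polyC \o polyC.

(* The generic line through the point P l, with direction (y, y^d, y^(d^2), ...)
   where y is the inner variable: monomials of total degree below d in the
   direction are distinct powers of y, so multivariate jets are not needed. *)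
Definition jet (d : nat) (l : 'I_N) (i : 'I_k) : A :=
  (P l i)%:P%:P + 'X * ('X^(d ^ i))%:P.

Lemma prod_eval_jet0 d l g :
  (prod_eval io (jet d l) g).[0] = (\prod_i (g i).[P l i])%:P.
Proof.
rewrite /prod_eval horner_prod rmorph_prod; apply: eq_bigr => i _.
rewrite -[_.[0]]/(horner_eval 0 _) -horner_map /= -map_poly_comp.
have -> : map_poly (horner_eval 0 \o io) (g i) = map_poly polyC (g i).
  by apply: eq_map_poly => c; rewrite /= /horner_eval hornerC.
by rewrite /horner_eval /jet hornerD hornerM hornerX mul0r addr0 hornerC horner_map.
Qed.

(* Vanishes at coordinate i of every point differing from P l there, but not at
   P l i. *)
Definition sep (l : 'I_N) (i : 'I_k) : {poly K} :=
  \prod_(l' | l' != l) (if P l' i == P l i then 1 else 'X - (P l' i)%:P).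

(** On the jet at any other point this is a multiple of ['X^d], thanks to [sep]; on the jet at [P l]
    it is the monomial with exponents [t] in the direction, up to a factor with nonzero constant
    term. *)
Definition test_poly d (l : 'I_N) (t : k.-tuple 'I_d) (i : 'I_k) : {poly K} :=
  sep l i ^+ d * ('X - (P l i)%:P) ^+ tnth t i.

Lemma horner_sep_neq0 l i : (sep l i).[P l i] != 0.
Proof.
rewrite horner_prod; apply/prodf_neq0 => l' _.
case: (P l' i =P P l i) => [_|/eqP ne]; first by rewrite -polyC1 hornerC oner_eq0.
by rewrite hornerXsubC subr_eq0 eq_sym.
Qed.

Lemma test_poly_other d l l' (t : k.-tuple 'I_d) : l' != l ->
  exists r, prod_eval io (jet d l') (test_poly l t) = 'X^d * r.
Proof.
move=> ne.
have /existsP[i nei] : [exists i, P l' i != P l i].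
  apply: contraNT ne => /existsPn eqPl; apply/eqP/inj_P => i.
  by have := eqPl i; rewrite negbK => /eqP.
rewrite /prod_eval (bigD1 i) //= /test_poly rmorphM rmorphXn /= /sep.
rewrite (bigD1 l') //= (negPf nei) !(rmorphM, rmorphXn) /= map_polyXsubC !hornerE.
rewrite /jet addrC addKr !exprMn -!mulrA.
by eexists; reflexivity.
Qed.

Lemma test_poly_same d l (t : k.-tuple 'I_d) :
  prod_eval io (jet d l) (test_poly l t) =
  prod_eval io (jet d l) (fun i => sep l i ^+ d) *
  ('X^(\sum_(i <- t) i) * ('X^(\sum_(i < k) tnth t i * d ^ i))%:P).
Proof.
rewrite big_tuple -!prodrXr rmorph_prod -big_split /prod_eval -big_split /=.
apply: eq_bigr => i _; rewrite rmorphM hornerM; congr (_ * _).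
rewrite !rmorphXn /= map_polyXsubC !hornerE /jet addrC addKr exprMn.
by rewrite -!rmorphXn /= -exprM mulnC.
Qed.

Variables (a : 'I_k -> 'I_k -> K) (b : 'I_k -> K).
Hypothesis inj_a : forall j, injective (a^~ j).
Hypothesis P_sol : forall i l, \prod_j (P l j - a i j) = b i.

(** The left side counts test polynomials, one for each point and each exponent vector of degree at
    most [n]; the right side counts reduced monomials. With more tests than monomials, the reduced
    forms satisfy a nontrivial relation, which the jet at a point [l0] with a nonzero coefficient
    refutes. *)
Lemma card_jets n : (N * 'C(k + n, k) <= (k + n.+1) ^ k)%N.
Proof.
set d := n.+1.
pose tup := {t : k.-tuple 'I_d | t \in [set t : k.-tuple 'I_d | (\sum_(i <- t) i <= n)%N]}.
pose row := ('I_N * tup)%type.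
have -> : (N * 'C(k + n, k))%N = #|{: row}|.
  rewrite card_prod card_ord card_sig -card_partial_ord_partitions.
  by congr (_ * _)%N; apply: eq_card => t; rewrite !inE.
have -> : ((k + d) ^ k)%N = #|{: {ffun 'I_k -> 'I_(k + d)}}|.
  by rewrite card_ffun !card_ord.
rewrite leqNgt; apply/negP => lt_card.
have tauP i l : exists r,
    prod_eval io (jet d l) (fun j => 'X - (a i j)%:P) = io (b i) + 'X * r.
  have [r rE] := poly_horner0_addX (prod_eval io (jet d l) (fun j => 'X - (a i j)%:P)).
  exists r; rewrite {1}rE prod_eval_jet0 -(P_sol i l); congr (_%:P%:P + _).
  by apply: eq_bigr => j _; rewrite !hornerE.
have spanP (r : row) : exists C : {ffun 'I_k -> 'I_(k + d)} -> K, forall l,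
    exists q, prod_eval io (jet d l) (test_poly r.1 (val r.2)) =
      \sum_e io (C e) * \prod_j jet d l j ^+ e j + 'X^d * q.
  have [w [C wE] eqw] := prod_eval_span_mod inj_a tauP d (test_poly r.1 (val r.2)).
  by exists C => l; have [q ->] := eqw l; exists q; rewrite wE.
have /fin_all_exists[C CP] := spanP.
have [c [[l0 t0] c_neq0] c_dep] := exists_linear_dependence C lt_card.
case/eqP: c_neq0; case: t0 => t0 t0P.
(* The share of [l0] in the relation, without the common factor coming from [sep]. *)
pose Q : A := \sum_(t : tup) io (c (l0, t)) *
  ('X^(\sum_(i <- val t) i) * ('X^(\sum_(i < k) tnth (val t) i * d ^ i))%:P).
have [S QE] : exists S, Q = 'X^d * S.
  apply: (@cancel_Xn _ (prod_eval io (jet d l0) (fun i => sep l0 i ^+ d))).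
    rewrite prod_eval_jet0 polyC_eq0; apply/prodf_neq0 => i _.
    by rewrite horner_exp expf_neq0 // horner_sep_neq0.
  have /fin_all_exists[q qE] : forall r : row, exists q,
      prod_eval io (jet d l0) (test_poly r.1 (val r.2)) =
      \sum_e io (C r e) * \prod_j jet d l0 j ^+ e j + 'X^d * q.
    by move=> r; apply: CP.
  have /fin_all_exists[q' q'E] : forall r : row, exists q, r.1 != l0 ->
      prod_eval io (jet d l0) (test_poly r.1 (val r.2)) = 'X^d * q.
    move=> r; case: (eqVneq r.1 l0) => [_|ne]; first by exists 0.
    have [|p ->] := @test_poly_other d r.1 l0 (val r.2); first by rewrite eq_sym.
    by exists p.
  (* The reduced forms cancel by the choice of [c]; only the multiples of ['X^d] remain. *)
  have tot : \sum_r io (c r) * prod_eval io (jet d l0) (test_poly r.1 (val r.2)) =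
      'X^d * \sum_r io (c r) * q r.
    under eq_bigr => r _ do rewrite qE mulrDr mulr_sumr.
    rewrite big_split /= exchange_big /= big1 ?add0r => [|e _].
      by rewrite mulr_sumr; apply: eq_bigr => r _; rewrite mulrCA.
    under eq_bigr => r _ do rewrite mulrA.
    rewrite -mulr_suml (_ : \sum_r _ = 0) ?mul0r //.
    apply: etrans (_ : io (\sum_r c r * C r e) = 0); last by rewrite c_dep rmorph0.
    rewrite (rmorph_sum io).
    by apply: eq_bigr => r _; rewrite (rmorphM io).
  exists (\sum_r io (c r) * q r - \sum_(r | r.1 != l0) io (c r) * q' r).
  rewrite mulrBr -tot (bigID (fun r : row => r.1 == l0)) /=; apply/eqP.
  rewrite eq_sym subr_eq; apply/eqP; congr (_ + _); last first.
    by rewrite mulr_sumr; apply: eq_bigr => r ne; rewrite q'E // mulrCA.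
  rewrite /Q mulr_sumr (reindex_onto (fun t : tup => (l0, t)) snd) /=; last first.
    by move=> [l t] /= /eqP ->.
  apply: eq_big => [t|t _].
    by rewrite !eqxx.
  by rewrite test_poly_same mulrCA.
(* The outer degree is the total degree of [t0], below [d], so the right side contributes nothing;
   the inner degree is [t0] read in base [d], which singles out [t0]. *)
have := congr1 (fun p : A => p`_(\sum_(i <- t0) i)`_(\sum_(i < k) tnth t0 i * d ^ i)) QE.
have lt_d : (\sum_(i <- t0) i < d)%N by move: t0P; rewrite inE.
rewrite /= coefXnM lt_d coef0 /Q !coef_sum (bigD1 (exist _ t0 t0P)) //=.
rewrite [X in _ + X]big1 ?addr0 => [|t ne].
  rewrite coefCM coefMC coefXn eqxx mul1r coefCM coefXn eqxx mulr1 => c0.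
  exact: c0.
rewrite coefCM coefMC coefXn coefCM.
case: eqP => [eqs|_]; last by rewrite mul0r coef0 mulr0.
rewrite mul1r coefXn; case: eqP => [eqd|_]; last by rewrite mulr0.
by case/eqP: ne; apply: val_inj; apply: digits_inj.
Qed.

(** As k! C(k + n, k) is at least (n + 1)^k, [card_jets] bounds N (n + 1)^k by k! (n + 1 + k)^k for
    every [n]. *)
Lemma norm_system_bound : (N <= k`!)%N.
Proof.
apply: (@le_of_asymptotic _ _ k) => n.
rewrite [(n.+1 + k)%N]addnC.
apply: leq_trans (leq_mul (leqnn k`!) (card_jets n)).
rewrite mulnCA leq_mul2l mulnC bin_ffact ffact_prod; apply/orP; right.
rewrite -[X in (_ ^ X <= _)%N]card_ord -prod_nat_const.
by apply: leq_prod => i _; have := ltn_ord i; lia.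
Qed.

End NormSystem.

(** * Expansion from small codegrees *)

Section Expansion.
Variables (V : finType) (e : rel V) (q k : nat).
Hypothesis sym_e : symmetric e.
Hypothesis q_gt1 : (1 < q)%N.
Hypothesis k_gt0 : (0 < k)%N.
Hypothesis cardV : #|V| = (q ^ k * q.-1)%N.
Hypothesis degV : forall x, #|[set v | e x v]| = (q ^ k).-1.
Hypothesis codegV : forall x y, x != y ->
  (#|[set v | e x v && e y v]| * q.-1 <= (q ^ k).-1)%N.

Lemma card_sum_rat (I : finType) (p : pred I) :
  (#|[set i | p i]|)%:R = \sum_i (p i)%:R :> rat.
Proof. by rewrite -sum1dep_card natr_sum big_mkcond; apply: eq_bigr => i _; case: (p i). Qed.

Let d (U : {set V}) (v : V) : rat := (#|[set w in U | e v w]|)%:R.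

Lemma sum_deg U : \sum_v d U v = (#|U| * (q ^ k).-1)%:R.
Proof.
transitivity (\sum_(w in U) \sum_v (e w v)%:R : rat).
  rewrite exchange_big; apply: eq_bigr => v _; rewrite /d card_sum_rat [RHS]big_mkcond.
  by apply: eq_bigr => w _; rewrite sym_e; case: (w \in U).
under eq_bigr => w _ do rewrite -card_sum_rat degV.
by rewrite sumr_const natrM mulr_natl.
Qed.

(** The sum of squared degrees counts common neighbours over ordered pairs from [U]; the diagonal
    pairs give degrees, the others codegrees. *)
Lemma sum_deg2 U : (q.-1)%:R * \sum_v d U v ^+ 2 <=
  (#|U| * (q ^ k).-1 * q.-1 + #|U| ^ 2 * (q ^ k).-1)%:R.
Proof.
have -> : \sum_v d U v ^+ 2 =
    \sum_(x in U) \sum_(y in U) (#|[set v | e x v && e y v]|)%:R.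
  transitivity (\sum_v \sum_(x in U) \sum_(y in U) ((e x v && e y v)%:R : rat)).
    apply: eq_bigr => v _; rewrite expr2 /d card_sum_rat.
    rewrite (_ : \sum_i _ = \sum_(x in U) (e x v)%:R); last first.
      by rewrite [RHS]big_mkcond; apply: eq_bigr => w _; rewrite sym_e; case: (w \in U).
    rewrite big_distrlr /=; apply: eq_bigr => x _; apply: eq_bigr => y _.
    by rewrite -natrM mulnb.
  rewrite exchange_big; apply: eq_bigr => x _; rewrite exchange_big.
  by apply: eq_bigr => y _; rewrite card_sum_rat.
rewrite mulr_sumr natrD [X in _ <= X](_ : _ =
  \sum_(x in U) ((q ^ k).-1 * q.-1 + #|U| * (q ^ k).-1)%:R); last first.
  by rewrite sumr_const -mulrnA -natrD; congr (_%:R); lia.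
apply: ler_sum => x xU; rewrite (bigD1 x) //= mulrDr natrD.
apply: lerD.
  rewrite -natrM ler_nat mulnC leq_mul2r -(degV x); apply/orP; right.
  by apply: subset_leq_card; apply/subsetP => v; rewrite !inE andbb.
rewrite mulr_sumr (le_trans (_ : _ <= \sum_(y in U) ((q ^ k).-1)%:R)) //; last first.
  by rewrite sumr_const -mulrnA mulnC.
rewrite [leRHS](bigD1 x) //= -[leLHS]add0r lerD ?ler0n //.
apply: ler_sum => y /andP[_ ne]; rewrite -natrM ler_nat mulnC.
by apply: codegV; rewrite eq_sym.
Qed.

Lemma expansion (U : {set V}) : (16 * q ^ k.+2 <= #|U| ^ 2)%N ->
  (#|U| <= 2 * #|[set v in U | #|U| <= 2 * q * #|[set w in U | e v w]|]|)%N.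
Proof.
set u := #|U| => u_big; set G := [set v in U | _].
pose B := U :\: G.
have uE : (u = #|G| + #|B|)%N.
  by rewrite /u -(cardsID G U) (setIidPr _) //; apply/subsetP => v; rewrite inE => /andP[].
suff : (#|B| * 2 <= u)%N by lia.
have qk_gt0 : (0 < q ^ k)%N by rewrite expn_gt0 (ltnW q_gt1).
have qk_gtq : (q <= q ^ k)%N by rewrite -[leqLHS]expn1 leq_exp2l.
pose D := (q ^ k).-1; have DE : (D.+1 = q ^ k)%N by rewrite prednK.
pose r := q.-1; have rE : (r.+1 = q)%N by rewrite prednK // ltnW.
(* Chebyshev's inequality for the deviation of the degrees into U from their
   mean u * D / n, rescaled by n to stay in the integers. *)
have [n nDef] : exists n, n = (q ^ k * r)%N by exists (q ^ k * r)%N.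
pose X v : rat := n%:R * d U v - (u * D)%:R.
have sumX : \sum_v X v ^+ 2 <= (2 * n ^ 2 * u * D)%:R.
  have -> : \sum_v X v ^+ 2 =
      n%:R ^+ 2 * \sum_v d U v ^+ 2 - n%:R * (u * D)%:R ^+ 2.
    transitivity (n%:R ^+ 2 * (\sum_v d U v ^+ 2) - 2 * n%:R * (u * D)%:R * (\sum_v d U v)
        + \sum_(v : V) (u * D)%:R ^+ 2).
      rewrite !mulr_sumr -sumrB -big_split; apply: eq_bigr => v _.
      by rewrite /X /=; ring.
    rewrite sum_deg sumr_const cardV -[(_ *+ _)]mulr_natl -nDef; ring.
  have := sum_deg2 U; rewrite -/u -/D -/r => le2.
  have nE : n%:R = (D%:R + 1) * r%:R :> rat by rewrite nDef natrM -DE -addn1 natrD.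
  have u_le : u%:R <= n%:R :> rat by rewrite ler_nat nDef -cardV max_card.
  have D0 : 0 <= D%:R :> rat by [].
  have r0 : 0 <= r%:R :> rat by [].
  have u0 : 0 <= u%:R :> rat by [].
  have n0 : 0 <= n%:R :> rat by [].
  have m1 : n%:R ^+ 2 * \sum_v d U v ^+ 2 <=
      n%:R * (D%:R + 1) * (u * D * r + u ^ 2 * D)%:R.
    rewrite [leLHS](_ : _ = n%:R * (D%:R + 1) * (r%:R * \sum_v d U v ^+ 2)).
      by rewrite ler_wpM2l // mulr_ge0 // addr_ge0.
    by rewrite expr2 {2}nE; ring.
  have m2 : n%:R * (u%:R * D%:R) * u%:R <= n%:R * (u%:R * D%:R) * n%:R :> rat.
    by rewrite ler_wpM2l // !mulr_ge0.
  apply: le_trans (lerB m1 (lexx _)) _.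
  rewrite [leLHS](_ : _ = n%:R * (u%:R * D%:R) * n%:R + n%:R * (u%:R * D%:R) * u%:R).
    rewrite !(natrM, natrX) [leRHS](_ : _ = n%:R * (u%:R * D%:R) * n%:R +
      n%:R * (u%:R * D%:R) * n%:R); last by ring.
    by rewrite lerD2l.
  by rewrite !(natrM, natrD, natrX) nE; ring.
(* Such a degree is at most half of the mean, because [r <= D]; the deviation is then at least half
   of the mean, whence the factor 4. *)
have BX v : v \in B -> (u * D)%:R ^+ 2 <= 4 * X v ^+ 2.
  rewrite !inE negb_and -ltnNge => /andP[+ vU]; rewrite vU /= => lt.
  have : (2 * (n * #|[set w in U | e v w]|) <= u * D)%N.
    rewrite nDef -DE; rewrite -rE in lt; nia.
  rewrite /X /d -(ler_nat rat) !natrM => le.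
  have : 0 <= n%:R * (#|[set w in U | e v w]|)%:R :> rat by rewrite mulr_ge0.
  nra.
have : (#|B| * (u * D) ^ 2 <= 8 * n ^ 2 * u * D)%N.
  rewrite -(ler_nat rat) (le_trans (_ : _ <= \sum_(v in B) 4 * X v ^+ 2)) //.
    by rewrite natrM natrX mulr_natl -sumr_const; apply: ler_sum.
  rewrite -mulr_sumr (le_trans (_ : _ <= 4 * \sum_v X v ^+ 2)) //.
    rewrite ler_wpM2l // [leRHS](bigID (mem B)) /= lerDl sumr_ge0 // => v _.
    exact: sqr_ge0.
  apply: (le_trans (ler_wpM2l _ sumX)) => //.
  by rewrite -natrM ler_nat; lia.
have u_gt0 : (0 < u)%N.
  have : (0 < u ^ 2)%N by rewrite (leq_trans _ u_big) // muln_gt0 expn_gt0 (ltnW q_gt1).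
  by rewrite expn_gt0 orbF.
have D_gt0 : (0 < D)%N by lia.
have nD : (n <= q * D)%N by rewrite nDef -DE -rE; nia.
have n_le : (n <= q ^ k.+1)%N by rewrite nDef expnSr leq_mul2l -rE leqnSn orbT.
move=> B_le.
have B1 : (#|B| * u * D <= 8 * n ^ 2)%N.
  by rewrite -(leq_pmul2r (_ : 0 < u * D)%N) ?muln_gt0 ?u_gt0 //; nia.
have B2 : (#|B| * u <= 8 * n * q)%N.
  rewrite -(leq_pmul2r D_gt0); apply: (leq_trans B1).
  by rewrite -!mulnA leq_mul2l -mulnn leq_mul2l nD !orbT.
have B3 : (#|B| * u <= 8 * q ^ k.+2)%N.
  by apply: (leq_trans B2); rewrite -mulnA leq_mul2l [(q ^ _.+2)%N]expnSr leq_mul2r n_le !orbT.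
rewrite -(leq_pmul2r u_gt0) mulnAC mulnn (leq_trans _ u_big) //.
by rewrite mulnC (_ : 16 = 2 * 8)%N // -mulnA leq_mul2l B3 orbT.
Qed.
End Expansion.

(** * Projective norm graphs *)

Section NormGraph.
Variables (L : finFieldType) (h k : nat).
Hypothesis charL : 2%N \in [pchar L].
Hypothesis h_gt0 : (0 < h)%N.
Hypothesis k_gt0 : (0 < k)%N.
Let q := (2 ^ h)%N.
Hypothesis cardL : #|L| = (q ^ k)%N.

Let M := (\sum_(j < k) q ^ j)%N.

(** The norm of [L] over its subfield with [q] elements. *)
Definition norm_pow (z : L) : L := z ^+ M.

(** The condition places the second coordinate among the nonzero elements of that subfield. *)
Definition norm_vertex := {v : L * L | v.2 ^+ q.-1 == 1}.

Definition norm_adj : rel norm_vertex :=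
  fun u v => norm_pow ((val u).1 + (val v).1) == (val u).2 * (val v).2.

Lemma norm_base_gt1 : (1 < q)%N.
Proof. by rewrite -[1%N]/(2 ^ 0)%N ltn_exp2l. Qed.

Lemma norm_exponent_gt0 : (0 < M)%N.
Proof. by rewrite /M; case: (k) k_gt0 => // k' _; rewrite big_ord_recl. Qed.

Lemma norm_exponentE : (M * q.-1)%N = (q ^ k).-1.
Proof. by rewrite predn_exp mulnC. Qed.

Lemma expr_frobD (x y : L) j : (x + y) ^+ (q ^ j) = x ^+ (q ^ j) + y ^+ (q ^ j).
Proof. by rewrite exprDn_pchar // /q -expnM pnatX pnatE // charL. Qed.

Lemma expr_frob_inj j : injective (fun x : L => x ^+ (q ^ j)).
Proof.
move=> x y /= exy; apply/eqP; rewrite -subr_eq0 oppr_pchar2 //.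
have : (x + y) ^+ (q ^ j) == 0 by rewrite expr_frobD exy addrr_pchar2.
by rewrite expf_eq0 => /andP[].
Qed.

Lemma norm_pow_prod z : norm_pow z = \prod_(j < k) z ^+ (q ^ j).
Proof. by rewrite /norm_pow prodrXr. Qed.

Lemma norm_pow0 : norm_pow 0 = 0.
Proof. by rewrite /norm_pow expr0n eqn0Ngt norm_exponent_gt0. Qed.

Lemma norm_pow_root z : z != 0 -> norm_pow z ^+ q.-1 = 1.
Proof.
move=> nz; rewrite /norm_pow -exprM norm_exponentE -cardL.
apply: (mulfI nz); rewrite mulr1 -exprS prednK ?expf_card //.
by apply/card_gt0P; exists 0.
Qed.

Lemma snd_neq0 (u : norm_vertex) : (val u).2 != 0.
Proof.
case: u => -[A a] /= a1; apply: contraTneq a1 => ->.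
by rewrite expr0n eqn0Ngt -subn1 subn_gt0 norm_base_gt1 /= eq_sym oner_eq0.
Qed.

Lemma norm_adjC : symmetric norm_adj.
Proof. by move=> u v; rewrite /norm_adj addrC mulrC. Qed.

Lemma norm_adjxx u : norm_adj u u = false.
Proof.
rewrite /norm_adj addrr_pchar2 // norm_pow0 eq_sym mulf_eq0 orbb.
exact/negbTE/snd_neq0.
Qed.

Lemma norm_adj_neq0 u v : norm_adj u v -> (val u).1 + (val v).1 != 0.
Proof.
move=> /eqP uv; apply/eqP => e0; move: uv; rewrite e0 norm_pow0 => /esym/eqP.
by rewrite mulf_eq0 !(negPf (snd_neq0 _)).
Qed.

Lemma norm_adj_fst_inj u u' v :
  norm_adj u v -> norm_adj u' v -> (val u).1 = (val u').1 -> u = u'.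
Proof.
move=> /eqP uv /eqP u'v e1; apply: val_inj.
rewrite [val u]surjective_pairing [val u']surjective_pairing -e1; congr (_, _).
by apply: (mulIf (snd_neq0 v)); rewrite -uv -u'v e1.
Qed.

Lemma card_norm_fiber c : (#|[set z | norm_pow z == c]| <= M)%N.
Proof.
rewrite cardE -ltnS -(size_XnsubC c norm_exponent_gt0).
apply: max_poly_roots (enum_uniq _).
  by rewrite -size_poly_gt0 size_XnsubC // norm_exponent_gt0.
apply/allP => z; rewrite mem_enum inE /root !hornerE /norm_pow => /eqP ->.
by rewrite subrr.
Qed.

(** For the lower bound, the norm sends the M (q - 1) nonzero elements of [L] to such roots, with at
    most [M] elements in each fibre. *)
Lemma card_unity_roots : #|[set a : L | a ^+ q.-1 == 1]| = q.-1.
Proof.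
have q1_gt0 : (0 < q.-1)%N by rewrite -subn1 subn_gt0 norm_base_gt1.
apply/eqP; rewrite eqn_leq; apply/andP; split.
  rewrite cardE; apply: max_unity_roots (enum_uniq _) => //.
  by apply/allP => a; rewrite mem_enum inE unity_rootE.
rewrite -(leq_pmul2l norm_exponent_gt0) norm_exponentE -cardL.
have <- : #|[set~ (0 : L)]| = #|L|.-1 by rewrite cardsC1.
rewrite -sum1_card (partition_big norm_pow (mem [set a : L | a ^+ q.-1 == 1])) /=; last first.
  by move=> z; rewrite !inE => nz; rewrite norm_pow_root.
rewrite mulnC -sum_nat_const; apply: leq_sum => c _.
rewrite sum1dep_card; apply: leq_trans (card_norm_fiber c).
by apply/subset_leq_card/subsetP => z; rewrite !inE => /andP[].
Qed.

Lemma card_norm_vertex : #|{: norm_vertex}| = (q ^ k * q.-1)%N.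
Proof.
rewrite card_sig -cardL.
transitivity #|setX [set: L] [set a : L | a ^+ q.-1 == 1]|.
  by apply: eq_card => -[A a]; rewrite in_setX !inE.
by rewrite cardsX cardsT card_unity_roots.
Qed.

(** The first coordinate of a neighbour can be anything but that of [x], in characteristic 2, and it
    determines the second. *)
Lemma norm_degree x : #|[set v | norm_adj x v]| = (q ^ k).-1.
Proof.
rewrite -cardL -(cardsC1 (val x).1).
rewrite -(card_in_imset (f := fun v : norm_vertex => (val v).1)); last first.
  move=> u v; rewrite !inE ![norm_adj x _]norm_adjC => ux vx.
  exact: norm_adj_fst_inj ux vx.
apply: eq_card => A; apply/imsetP/idP => [[v + ->]|].
  rewrite !inE => /norm_adj_neq0; apply: contraNneq => <-.
  by rewrite addrr_pchar2.
rewrite !inE => neA; pose a := norm_pow ((val x).1 + A) / (val x).2.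
have nz : (val x).1 + A != 0.
  by rewrite -[A](oppr_pchar2 charL) subr_eq0 eq_sym.
have a1 : a ^+ q.-1 == 1.
  by rewrite expr_div_n norm_pow_root //= (eqP (valP x)) divr1.
exists (exist _ (A, a) a1) => //; rewrite inE /norm_adj /= /a mulrC divfK //.
exact: snd_neq0.
Qed.

(** A common neighbour is determined by the ratio of its two sums with [x] and [y], a nondegenerate
    Moebius function of its first coordinate, and the norm of this ratio is fixed. *)
Lemma norm_codegree x y : x != y ->
  (#|[set v | norm_adj x v && norm_adj y v]| * q.-1 <= (q ^ k).-1)%N.
Proof.
move=> nexy; rewrite -norm_exponentE leq_mul2r; apply/orP; right.
have [e1|ne1] := eqVneq (val x).1 (val y).1.
  rewrite (_ : [set _ | _] = set0) ?cards0 //; apply/setP => v; rewrite !inE.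
  apply/negP => /andP[xv yv]; case/eqP: nexy; exact: norm_adj_fst_inj xv yv e1.
apply: leq_trans (card_norm_fiber ((val x).2 / (val y).2)).
pose f (v : norm_vertex) := ((val x).1 + (val v).1) / ((val y).1 + (val v).1).
rewrite -(card_in_imset (f := f)).
  apply/subset_leq_card/subsetP => _ /imsetP[v + ->].
  rewrite !inE => /andP[/eqP xv /eqP yv].
  rewrite /norm_pow /f expr_div_n -!/(norm_pow _) xv yv.
  by rewrite -mulf_div divff ?mulr1 // snd_neq0.
move=> u v; rewrite !inE => /andP[xu yu] /andP[xv yv].
move/eqP; rewrite /f eqr_div ?norm_adj_neq0 // => /eqP fuv.
have /eqP : ((val x).1 - (val y).1) * ((val v).1 - (val u).1) = 0.
  by move/eqP: fuv; rewrite -subr_eq0 => /eqP <-; ring.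
rewrite mulf_eq0 !subr_eq0 (negPf ne1) /= => /eqP/esym.
by apply: norm_adj_fst_inj; rewrite norm_adjC; [exact: xu | exact: xv].
Qed.

Lemma norm_common (S : {set norm_vertex}) : #|S| = k.+1 ->
  (#|[set v | [forall u in S, norm_adj u v]]| <= k`!)%N.
Proof.
move=> cardS; set T := [set v | _].
have [-> | [v0 v0T]] := set_0Vmem T; first by rewrite cards0.
have adjT u v : u \in S -> v \in T -> norm_adj u v.
  by move=> uS; rewrite inE => /forall_inP; apply.
have fst_inj u u' : u \in S -> u' \in S -> (val u).1 = (val u').1 -> u = u'.
  by move=> uS u'S; apply: (@norm_adj_fst_inj _ _ v0); apply: adjT.
have /card_gt0P[u0 u0S] : (0 < #|S|)%N by rewrite cardS.
have cardS' : #|S :\ u0| = k.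
  by have := cardsD1 u0 S; rewrite u0S cardS add1n => -[].
pose f (i : 'I_k) := enum_val (cast_ord (esym cardS') i).
have fP i : f i \in S :\ u0 by apply: enum_valP.
have fS i : f i \in S by have := fP i; rewrite inE => /andP[].
have f_inj : injective f by move=> i j /enum_val_inj/cast_ord_inj.
have fne i : (val (f i)).1 + (val u0).1 != 0.
  rewrite -[(val u0).1](oppr_pchar2 charL) subr_eq0.
  apply/eqP => /fst_inj e; have := fP i; rewrite e ?fS // !inE.
  by rewrite eqxx.
(* Dividing the equations norm (A + B_i) = a b_i by the one for u0 eliminates a,
   and the substitution X = 1 / (A + B_0) turns them into norm (X + c_i) = b i. *)
pose X (l : 'I_#|T|) := ((val (enum_val l)).1 + (val u0).1)^-1.
pose c i := ((val (f i)).1 + (val u0).1)^-1.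
pose b i := (val (f i)).2 / ((val u0).2 * norm_pow ((val (f i)).1 + (val u0).1)).
(* The norm is the product of the [k] conjugates, so the powers [X l ^+ (q ^ j)] serve as separate
   unknowns; injectivity of the Frobenius map keeps solutions and nodes distinct. *)
apply: (@norm_system_bound L k #|T| (fun l j => X l ^+ (q ^ j))
  _ (fun i j => c i ^+ (q ^ j)) b).
- move=> l l' /(_ (Ordinal k_gt0)) /= /expr_frob_inj/invr_inj/addIr e1.
  apply: enum_val_inj; apply: (@norm_adj_fst_inj _ _ u0) e1.
    by rewrite norm_adjC adjT ?enum_valP.
  by rewrite norm_adjC adjT ?enum_valP.
- move=> j i i' /expr_frob_inj/invr_inj/addIr /fst_inj e.
  by apply/f_inj/e.
move=> i l.
have vT : enum_val l \in T by apply: enum_valP.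
set v := enum_val l in vT *.
transitivity (norm_pow (X l + c i)).
  rewrite norm_pow_prod; apply: eq_bigr => j _.
  by rewrite expr_frobD -[X in _ - X]oppr_pchar2 // opprK.
have /eqP uv := adjT _ _ u0S vT; have /eqP fv := adjT _ _ (fS i) vT.
have nz : (val v).1 + (val u0).1 != 0 by rewrite addrC norm_adj_neq0 // adjT.
have -> : X l + c i = ((val (f i)).1 + (val v).1) /
    (((val u0).1 + (val v).1) * ((val (f i)).1 + (val u0).1)).
  have -> : (val (f i)).1 + (val v).1 =
      ((val (f i)).1 + (val u0).1) + ((val v).1 + (val u0).1).
    by rewrite addrACA addrr_pchar2 // addr0.
  rewrite /X /c -/v [(val u0).1 + _]addrC mulrDl; congr (_ + _).
    by rewrite [RHS]mulrC invfM -mulrA mulVf ?mulr1 ?fne.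
  by rewrite invfM mulrA mulfV ?mul1r.
rewrite /norm_pow expr_div_n exprMn -!/(norm_pow _) uv fv /b.
by rewrite [(val u0).2 * _ * _]mulrAC -mulf_div divff ?mulr1 // snd_neq0.
Qed.

End NormGraph.

(** * The lower bound for [ex] from norm graphs *)

Local Open Scope nat_scope.

Lemma ex_complete_norm_graph (m s t h n : nat) :
    2 <= m -> 2 * m - 2 <= s -> (s - 1)`! + 1 <= t -> 4 ^ m.+1 <= 2 ^ h -> (2 ^ h) ^ s <= n ->
  ((2 ^ h) ^ s) ^ m <= ex n (complete_graph m) (complete_bipartite s t) *
    (m ^ m * 2 ^ m * 2 ^ m.-1 * (2 * 2 ^ h) ^ 'C(m, 2)).
Proof.
move=> m_ge2 s_ge t_ge; set q := 2 ^ h => q_ge le_n.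
have m_gt0 : 0 < m by lia.
have s_gt1 : 1 < s by lia.
have t_gt0 : 0 < t by lia.
have [k sE] : exists k, s = k.+1 by exists s.-1; lia.
have k_gt0 : 0 < k by lia.
have q_gt1 : 1 < q by apply: leq_trans q_ge; rewrite -[X in X < _](expn0 4) ltn_exp2l.
have h_gt0 : 0 < h by rewrite lt0n; apply: contraTneq q_gt1 => h0; rewrite /q h0.
have hk_gt0 : 0 < h * k by rewrite muln_gt0 h_gt0.
have [L charL] := PrimePowerField (isT : prime 2) hk_gt0; rewrite expnM => cardL.
pose W := norm_vertex L h; pose e : rel W := @norm_adj L h k.
have e_sym : symmetric e := @norm_adjC L h k.
have e_irr : irreflexive e.
  by move=> u; apply: (norm_adjxx charL h_gt0 k_gt0).
have cardW : #|{: W}| = q ^ k * q.-1 := card_norm_vertex h_gt0 k_gt0 cardL.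
have e_free (S : {set W}) : #|S| = s -> #|common e S| < t.
  rewrite sE => /(norm_common charL h_gt0 k_gt0) le_k.
  by apply: leq_ltn_trans le_k _; move: t_ge; rewrite sE subn1 addn1.
have W_le : #|{: W}| <= n.
  by apply: leq_trans le_n; rewrite cardW sE expnSr leq_mul2l leq_pred orbT.
have W_ge : q ^ s <= 2 * #|{: W}|.
  by rewrite cardW sE expnSr mulnCA leq_mul2l; apply/orP; right; lia.
have expW := expansion e_sym q_gt1 k_gt0 cardW (norm_degree charL h_gt0 k_gt0 cardL)
  (@norm_codegree L h k h_gt0 k_gt0).
have := cliques_lower (ltnW q_gt1) expW (m := m.-1) (U := [set: W]).
rewrite cardsT prednK // => /(_ _)/leq_trans low.
apply: leq_trans (_ : 2 ^ m * #|{: W}| ^ m <= _).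
  by rewrite -expnMn leq_exp2r.
rewrite -!mulnA mulnA mulnCA leq_mul2l; apply/orP; right.
apply: low; last first.
  by rewrite leq_mul2r ex_complete_ge ?orbT // ltnW.
(* The threshold of [cliques_lower]: the assumption on [q] absorbs the constant, and s + 2m <= 2s +
   2 is exactly [2 * m - 2 <= s]. *)
have -> : 16 * q ^ k.+2 * (2 * q) ^ (2 * m.-1) = 4 ^ m.+1 * q ^ (s + 2 * m).-1.
  rewrite expnMn [2 ^ _]expnM -[2 ^ 2]/4 -[16]/(4 ^ 2) -mulnA [q ^ k.+2 * _]mulnCA.
  by rewrite mulnA -!expnD; congr (4 ^ _ * q ^ _); lia.
apply: leq_trans (_ : q * q ^ (s + 2 * m).-1 <= _); first by rewrite leq_mul2r q_ge orbT.
rewrite -expnS -expnMn mulnA [_ * 2]mulnC.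
apply: leq_trans (_ : (q ^ s * q) ^ 2 <= _); last by rewrite leq_exp2r // leq_mul2r W_ge orbT.
by rewrite -expnSr -expnM leq_exp2l //; lia.
Qed.

(** Rounding down to a power of 2 finds [2 ^ h] with (2^h)^s <= n < (2^(h+1))^s; taking [Q] as
    2^(h+1) costs the factor [2 ^ (s * m)]. *)
Lemma ex_complete_lower (m s t n : nat) :
    2 <= m -> 2 * m - 2 <= s -> (s - 1)`! + 1 <= t -> (2 ^ s) ^ (2 * m.+1) <= n ->
  exists2 Q, n <= Q ^ s & Q ^ (s * m - 'C(m, 2)) <=
    ex n (complete_graph m) (complete_bipartite s t) *
    (m ^ m * 2 ^ m * 2 ^ m.-1 * 2 ^ (s * m)).
Proof.
move=> m_ge2 s_ge t_ge n_ge.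
have s_gt0 : 0 < s by lia.
have P_gt1 : 1 < 2 ^ s by rewrite -[X in X < _](expn0 2) ltn_exp2l.
pose h := trunc_log (2 ^ s) n.
have n_gt0 : 0 < n by apply: leq_trans n_ge; rewrite expn_gt0 expn_gt0.
have /andP[n_lo n_hi] := trunc_log_bounds P_gt1 n_gt0.
have h_ge : 2 * m.+1 <= h by apply: trunc_log_max.
have q_ge : 4 ^ m.+1 <= 2 ^ h by rewrite -[4]/(2 ^ 2) -expnM leq_exp2l.
have q_lo : (2 ^ h) ^ s <= n by rewrite -expnM mulnC expnM.
exists (2 * 2 ^ h).
  by rewrite -expnS -expnM mulnC expnM ltnW.
have C_le : 'C(m, 2) <= s * m.
  have : m.-1 * m <= s * m by rewrite leq_mul2r; apply/orP; right; lia.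
  by rewrite bin2 mulnC; set N := m.-1 * m; lia.
have Q_gt0 : 0 < (2 * 2 ^ h) ^ 'C(m, 2) by rewrite expn_gt0 muln_gt0 expn_gt0.
rewrite -(leq_pmul2r Q_gt0) -expnD subnK // expnMn [(2 ^ h) ^ (s * m)]expnM.
have := ex_complete_norm_graph m_ge2 s_ge t_ge q_ge q_lo.
rewrite -(leq_pmul2l (_ : 0 < 2 ^ (s * m))) ?expn_gt0 // => low.
apply: leq_trans low _.
by rewrite leq_eqVlt; apply/orP; left; apply/eqP; ring.
Qed.

(** * Asymptotics *)

From mathcomp Require Import all_classical all_reals all_analysis.

Local Open Scope ring_scope.

(** Beyond [D], the power of exponent [a - s <= 0] is decreasing. *)
Lemma powR_le_split (R : realType) (x D a s : R) : 0 <= x -> 0 < D -> 0 <= a -> a <= s ->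
  x `^ a <= D `^ a + D `^ (a - s) * x `^ s.
Proof.
move=> x0 D0 a0 le_as; have [le_xD|lt_Dx] := leP x D.
  rewrite -[leLHS]addr0 lerD ?mulr_ge0 ?powR_ge0 //.
  by rewrite ge0_ler_powR // nnegrE ltW.
rewrite -[leLHS]add0r lerD ?powR_ge0 //.
have x_gt0 : 0 < x := lt_trans D0 lt_Dx.
have {1}-> : a = (a - s) + s by rewrite subrK.
rewrite powRD; last by rewrite (gt_eqF x_gt0) implybT.
rewrite ler_wpM2r ?powR_ge0 // -[a - s]opprK opprB !powRN.
rewrite lef_pV2 ?posrE ?powR_gt0 // ge0_ler_powR ?subr_ge0 // ?nnegrE ltW //.
Qed.

(** Induction on [m] for all [s]: the rest of a clique lies in the neighbourhood of its first
    vertex, where the codegree condition holds with [s] lowered by one. *)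
Lemma cliques_upper (R : realType) (t m s : nat) : (m <= s)%N ->
  exists2 C : R, 0 <= C & forall (V : finType) (e : rel V) (U : {set V}),
    symmetric e -> irreflexive e -> codegree_lt e s t U ->
    (cliques e m.+1 U)%:R <= C * #|U|%:R `^ (m.+1%:R - 'C(m.+1, 2)%:R / s%:R).
Proof.
elim: m s => [|m IHm] s le_ms.
  exists 1 => // V e U _ _ _.
  by rewrite cliques1 /= mul0r subr0 mul1r powRr1.
case: s le_ms => [//|s]; rewrite ltnS => le_ms.
have [C C0 CP] := IHm s le_ms.
pose K := ((2 * s.+1) ^ s.+1 + 2 ^ s.+1 * t)%N.
exists (C * (1 + K%:R)); first by rewrite mulr_ge0 // addr_ge0.
move=> V e U sym_e irr_e freeU; rewrite cliquesS natr_sum.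
set n := #|U|; set E := (X in _ `^ X).
have [n0|n_gt0] := posnP n.
  rewrite (_ : \sum_(v in U) _ = 0) ?mulr_ge0 ?addr_ge0 ?powR_ge0 //.
  by apply: big1 => v; rewrite (cards0_eq n0) inE.
have nR : 0 < n%:R :> R by rewrite ltr0n.
pose a : R := m.+1%:R - 'C(m.+1, 2)%:R / s%:R.
pose d v := #|[set w in U | e v w]|.
have C2 : 'C(m.+1, 2)%:R * 2 = m.+1%:R * m%:R :> R.
  by rewrite -!natrM bin2 muln2 -[in RHS](odd_double_half (m.+1 * m.+1.-1)) oddM /= andNb.
have C3 : 'C(m.+2, 2)%:R = 'C(m.+1, 2)%:R + m.+1%:R :> R.
  by rewrite -natrD binS bin1.
have sR : 0 < s.+1%:R :> R by rewrite ltr0n.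
have mS : m.+1%:R = m%:R + 1 :> R by rewrite -natr1.
have sS : s.+1%:R = s%:R + 1 :> R by rewrite -natr1.
have m0 : 0 <= m%:R :> R by [].
have le_msR : m%:R <= s%:R :> R by rewrite ler_nat.
have as_eq : a * s%:R = m.+1%:R * s%:R - 'C(m.+1, 2)%:R.
  (* If [s] is 0 then so are [m] and the binomial, so the division by zero is harmless. *)
  rewrite /a mulrBl; have [s0|s_gt0] := posnP s.
    by move: le_ms; rewrite s0 leqn0 => /eqP ->; rewrite !mulr0 subr0.
  by rewrite divfK // pnatr_eq0 -lt0n.
have q_ge0 : 0 <= 'C(m.+1, 2)%:R / s%:R :> R by rewrite divr_ge0.
have a_ge0 : 0 <= a.
  rewrite subr_ge0; have [s0|s_gt0] := posnP s; first by rewrite s0 invr0 mulr0.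
  rewrite ler_pdivrMr ?ltr0n //; nra.
have a_le : a <= s.+1%:R.
  by rewrite /a; lra.
(* Degrees up to the typical size D are bounded by D, the others are controlled
   by the s-th moment; D is chosen to make both contributions equal to n^E. *)
pose D := n%:R `^ (s%:R / s.+1%:R) : R.
have D_gt0 : 0 < D by apply: powR_gt0.
have nimpl (x : R) : (x == 0) ==> (n%:R != 0 :> R) by rewrite (gt_eqF nR) implybT.
have EE : E = 1 + (m.+1%:R * s%:R - 'C(m.+1, 2)%:R) / s.+1%:R.
  rewrite /E C3 -[m.+2%:R]natr1 sS; field.
  by rewrite -sS gt_eqF.
have E1 : n%:R * D `^ a = n%:R `^ E :> R.
  rewrite /D -powRrM -{1}[n%:R]powRr1 ?ler0n // -powRD ?nimpl //; congr (_ `^ _).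
  by rewrite mulrAC [s%:R * a]mulrC as_eq EE.
have E2 : D `^ (a - s.+1%:R) * n%:R ^+ s.+1 = n%:R `^ E :> R.
  rewrite /D -powRrM -powR_mulrn ?ler0n // -powRD ?nimpl //; congr (_ `^ _).
  rewrite mulrAC mulrBr [s%:R * a]mulrC as_eq EE sS; field.
  by rewrite -sS gt_eqF.
apply: le_trans (_ : \sum_(v in U) C * (D `^ a + D `^ (a - s.+1%:R) * (d v)%:R `^ s.+1%:R) <= _).
  apply: ler_sum => v vU.
  apply: le_trans (CP _ _ _ sym_e irr_e (codegree_lt_nbhd sym_e irr_e vU freeU)) _.
  by rewrite ler_wpM2l // powR_le_split.
rewrite -mulr_sumr -mulrA ler_wpM2l // big_split /=.
rewrite sumr_const -[X in X + _]mulr_natl E1.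
rewrite mulrDl mul1r lerD2l -mulr_sumr.
rewrite -E2 mulrCA ler_wpM2l ?powR_ge0 //.
under eq_bigr => v _ do rewrite powR_mulrn // -natrX.
rewrite -natr_sum -natrX -natrM ler_nat.
exact: sum_degree_expn.
Qed.

(** The lower bound is restricted to [m <= n], since fewer vertices carry no copy of K_m. *)
Theorem theorem1p3 (R : realType) (m s t : nat)
    (m_ge2 : (2 <= m)%N)
    (s_le_t : (s <= t)%N)
    (s_ge : (2 * m - 2 <= s)%N)
    (t_ge : ((s - 1)`! + 1 <= t)%N) :
  exists c1 c2 : R, 0 < c1 /\
    forall n : nat,
      ((m <= n)%N ->
        c1 * n%:R `^ (m%:R - 'C(m, 2)%:R / s%:R)
          <= (ex n (complete_graph m) (complete_bipartite s t))%:R) /\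
      (ex n (complete_graph m) (complete_bipartite s t))%:R
          <= c2 * n%:R `^ (m%:R - 'C(m, 2)%:R / s%:R).
Proof.
have m_gt0 : (0 < m)%N by lia.
have s_gt0 : (0 < s)%N by lia.
have t_gt0 : (0 < t)%N by lia.
have le_ms : (m.-1 <= s)%N by lia.
have [C C0 upper] := cliques_upper R t le_ms; rewrite prednK // in upper.
set E := (m%:R - _ : R) in upper *.
pose K : R := (m ^ m * 2 ^ m * 2 ^ m.-1 * 2 ^ (s * m))%:R.
pose n0 := ((2 ^ s) ^ (2 * m.+1))%N.
have K_gt0 : 0 < K by rewrite ltr0n !muln_gt0 !expn_gt0 m_gt0.
have den_gt0 : 0 < K + n0%:R `^ E by rewrite ltr_wpDr ?powR_ge0.
have C_le : ('C(m, 2) <= s * m)%N.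
  have : (m.-1 * m <= s * m)%N by rewrite leq_mul2r le_ms orbT.
  by rewrite bin2 mulnC; set N := (m.-1 * m)%N; lia.
have sR : 0 < s%:R :> R by rewrite ltr0n.
have sE : s%:R * E = (s * m - 'C(m, 2))%:R.
  by rewrite natrB // natrM /E mulrBr mulrCA divff ?mulr1 // gt_eqF.
have E0 : 0 <= E by rewrite -(pmulr_rge0 _ sR) sE.
exists (K + n0%:R `^ E)^-1, C; rewrite invr_gt0; split => // n; split; last first.
  rewrite /ex; elim/big_ind: _ => [|x y|G /andP[sG free]].
  - by rewrite mulr_ge0 ?powR_ge0.
  - by move=> xP yP; rewrite /maxn; case: ifP.
  rewrite (le_trans (_ : _ <= (cliques (adj G) m [set: 'I_n])%:R)) //.
    by rewrite ler_nat copies_complete_le.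
  have := upper _ (adj G) [set: 'I_n]%SET (@adjC _ G) (adjxx sG).
  rewrite cardsT card_ord; apply=> S _ cardS.
  by rewrite finset.setIT; apply: graph_free_common cardS.
move=> le_mn; rewrite ler_pdivrMl // mulrC.
have [le_n|lt_n] := leqP n0 n.
  (* By [sE], raising [n <= Q ^ s] to the power [E] gives the natural power of [Q] bounded in
     [exQ]. *)
  have [Q n_le exQ] := ex_complete_lower m_ge2 s_ge t_ge le_n.
  apply: le_trans (_ : (ex n (complete_graph m) (complete_bipartite s t))%:R * K <= _).
    rewrite /K -natrM (le_trans _ (_ : (Q ^ (s * m - 'C(m, 2)))%:R <= _)) ?ler_nat //.
    rewrite natrX -powR_mulrn // -sE powRrM powR_mulrn // -natrX.
    by rewrite ge0_ler_powR // ?nnegrE // ler_nat.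
  by rewrite ler_wpM2l // lerDl powR_ge0.
have ex_ge1 : 1 <= (ex n (complete_graph m) (complete_bipartite s t))%:R :> R.
  by rewrite ler1n ex_complete_gt0 //; lia.
apply: le_trans (_ : 1 * (K + n0%:R `^ E) <= _); last by rewrite ler_wpM2r // ltW.
rewrite mul1r ler_wpDl ?(ltW K_gt0) //.
by rewrite ge0_ler_powR // ?nnegrE // ler_nat ltnW.
Qed.
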